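(* Let $L$ be a lattice with zero. Then the following conditions are equivalent: (i) $M_3\otimes L$ is a lattice. (ii) For all $\langle x, y, z\rangle\in L^3$, there exists $n>0$ such that $\langle x, y, z\rangle^{(n)}=\langle x, y, z\rangle^{(n + 1)}$. Furthermore, if (i) is satisfied, then $M_3\otimes L\cong M_3[L]$. In particular, if $L$ is $n$-modular, for some $n>0$, then $M_3 \otimes L$ is a lattice, and $M_3 \otimes L \cong M_3[L]$.
   Context: $M_3$ is the five-element modular nondistributive lattice (least element, greatest element, and three atoms). For a lattice $L$, a triple $\langle x,y,z\rangle \in L^3$ is balanced if $x\wedge y = x\wedge z = y\wedge z$. $M_3[L]$ denotes the set of all balanced triples, regarded as a subposet of $L^3$ (componentwise order). Define lattice polynomials in the variables $x,y,z$ by $p_0=x$, $q_0=y$, $r_0=z$, and $p_{n+1}=p_n\vee(q_n\wedge r_n)$, $q_{n+1}=q_n\vee(p_n\wedge r_n)$, $r_{n+1}=r_n\vee(p_n\wedge q_n)$. For $\langle x,y,z\rangle\in L^3$ and $n>0$, put $\langle x,y,z\rangle^{(n)}=\langle p_n(x,y,z),q_n(x,y,z),r_n(x,y,z)\rangle$. For $n>0$, a lattice is $n$-modular if it satisfies the identity $p_n=p_{n+1}$. Tensor products: let $A$ and $B$ be $\{\vee,0\}$-semilattices. A bi-ideal of $A\times B$ is a subset $I\subseteq A\times B$ such that: $I$ is hereditary (downward closed in the componentwise order); $I$ contains $\nabla_{A,B}=(A\times\{0\})\cup(\{0\}\times B)$; if $\langle a_0,b\rangle,\langle a_1,b\rangle\in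 I$ then $\langle a_0\vee a_1,b\rangle\in I$; if $\langle a,b_0\rangle,\langle a,b_1\rangle\in I$ then $\langle a,b_0\vee b_1\rangle\in I$. The bi-ideals, ordered by inclusion, form an algebraic lattice, and the tensor product $A\otimes B$ is the $\{\vee,0\}$-subsemilattice of its compact elements. Saying that $A\otimes B$ is a lattice means that this poset is a lattice. *)

(* Defs.v *)
From HB Require Import structures.
From mathcomp Require Import all_boot all_order.
From mathcomp Require Import boolp classical_sets cardinality.

Set Implicit Arguments.
Unset Strict Implicit.
Unset Printing Implicit Defensive.

Import Order.TTheory.
Local Open Scope classical_set_scope.
Local Open Scope order_scope.

Fixpoint pol_p d (L : latticeType d) (n : nat) (x y z : L) : L :=
  if n is m.+1 then pol_p m x y z `|` (pol_q m x y z `&` pol_r m x y z) else x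
with pol_q d (L : latticeType d) (n : nat) (x y z : L) : L :=
  if n is m.+1 then pol_q m x y z `|` (pol_p m x y z `&` pol_r m x y z) else y
with pol_r d (L : latticeType d) (n : nat) (x y z : L) : L :=
  if n is m.+1 then pol_r m x y z `|` (pol_p m x y z `&` pol_q m x y z) else z.

Definition triple_pol d (L : latticeType d) (n : nat) (x y z : L) : L * L * L :=
  (pol_p n x y z, pol_q n x y z, pol_r n x y z).

Definition n_modular d (L : latticeType d) (n : nat) : Prop :=
  forall x y z : L, pol_p n x y z = pol_p n.+1 x y z.

Definition is_lattice d (P : porderType d) : Prop :=
  forall x y : P, supremums [set x; y] !=set0 /\ infimums [set x; y] !=set0.

Definition poset_iso d1 (P : porderType d1) d2 (Q : porderType d2) : Prop :=
  exists2 f : P -> Q, bijective f & {mono f : x y / x <= y}.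

(* In a complete lattice this is compactness: if x is below the join of F,
   then x is below the join of some finite subset of F. *)
Definition compact_element d (P : porderType d) (x : P) : Prop :=
  forall (F : set P) (s : P), supremums F s -> x <= s ->
  exists G : set P, [/\ finite_set G, G `<=` F &
    exists2 t : P, supremums G t & x <= t].

Section BalancedTriples.
Variables (d : Order.disp_t) (L : latticeType d).

Definition balanced : pred (L *p L *p L) :=
  fun t => let: (x, y, z) := t in
    (x `&` y == x `&` z) && (x `&` z == y `&` z).

Record balanced_triples := BalancedTriple {
  btriple :> L *p L *p L;
  btripleP : balanced btriple }.

HB.instance Definition _ := [isSub for btriple].
HB.instance Definition _ := [Choice of balanced_triples by <:].
HB.instance Definition _ :=
  [SubChoice_isSubPOrder of balanced_triples by <: with d].

End BalancedTriples.

Section TensorProduct.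
Variables (d1 d2 : Order.disp_t).
Variables (A : bJoinSemilatticeType d1) (B : bJoinSemilatticeType d2).

Record bi_ideal (I : set (A * B)) : Prop := BiIdeal {
  bi_ideal_hereditary : forall a a' b b',
    a <= a' -> b <= b' -> I (a', b') -> I (a, b);
  bi_ideal_nabla : [set ab : A * B | ab.2 = \bot] `|`
                   [set ab : A * B | ab.1 = \bot] `<=` I;
  bi_ideal_joinl : forall a0 a1 b, I (a0, b) -> I (a1, b) -> I (a0 `|` a1, b);
  bi_ideal_joinr : forall a b0 b1, I (a, b0) -> I (a, b1) -> I (a, b0 `|` b1) }.

(* The order inherited from set (A * B) is inclusion. *)
Record bi_ideals := BiIdeals {
  biset :> set (A * B);
  bisetP : `[< bi_ideal biset >] }.

HB.instance Definition _ := [isSub for biset].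
HB.instance Definition _ := [Choice of bi_ideals by <:].
HB.instance Definition _ :=
  [SubChoice_isSubPOrder of bi_ideals by <: with set_display].

Record tensor := Tensor {
  tensor_val :> bi_ideals;
  tensorP : `[< compact_element tensor_val >] }.

HB.instance Definition _ := [isSub for tensor_val].
HB.instance Definition _ := [Choice of tensor by <:].
HB.instance Definition _ :=
  [SubChoice_isSubPOrder of tensor by <: with set_display].

End TensorProduct.

Inductive M3 := M3_bot | M3_a | M3_b | M3_c | M3_top.

Module M3Theory.

Definition to_ord (x : M3) : 'I_5 :=
  match x with
  | M3_bot => inord 0 | M3_a => inord 1 | M3_b => inord 2
  | M3_c => inord 3 | M3_top => inord 4
  end.

Definition of_ord (i : 'I_5) : M3 := nth M3_top [:: M3_bot; M3_a; M3_b; M3_c] i.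

Lemma to_ordK : cancel to_ord of_ord.
Proof. by case; rewrite /of_ord /= inordK. Qed.

HB.instance Definition _ := Finite.copy M3 (can_type to_ordK).

Definition le (x y : M3) : bool :=
  match x, y with
  | M3_bot, _ | _, M3_top => true
  | _, _ => x == y
  end.

Definition meet (x y : M3) : M3 :=
  if le x y then x else if le y x then y else M3_bot.

Definition join (x y : M3) : M3 :=
  if le x y then y else if le y x then x else M3_top.

Lemma eqE (x y : M3) : (x == y) =
  match x, y with
  | M3_bot, M3_bot | M3_a, M3_a | M3_b, M3_b | M3_c, M3_c | M3_top, M3_top =>
    true
  | _, _ => false
  end.
Proof. by case: x y => [] []; apply/eqP. Qed.

Local Definition E := (eqE, eqxx).

Lemma le_refl : reflexive le. Proof. by case; rewrite /= ?E. Qed.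
Lemma le_anti : antisymmetric le.
Proof. by case=> [] []; rewrite /le ?E. Qed.
Lemma le_trans : transitive le.
Proof. by case=> [] [] []; rewrite /le ?E. Qed.

Fact M3_display : Order.disp_t. Proof. exact: Order.Disp tt tt. Qed.

HB.instance Definition _ :=
  Order.Le_isPOrder.Build M3_display M3 le_refl le_anti le_trans.

Lemma meetC : commutative meet.
Proof. by case=> [] []; rewrite /meet /le ?E. Qed.
Lemma joinC : commutative join.
Proof. by case=> [] []; rewrite /join /le ?E. Qed.
Lemma meetA : associative meet.
Proof. by case=> [] [] []; rewrite /meet /le ?E //= ?E. Qed.
Lemma joinA : associative join.
Proof. by case=> [] [] []; rewrite /join /le ?E //= ?E. Qed.
Lemma joinKI y x : meet x (join x y) = x.
Proof. by case: x y => [] []; rewrite /meet /join /le ?E //= ?E. Qed.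
Lemma meetKU y x : join x (meet x y) = x.
Proof. by case: x y => [] []; rewrite /meet /join /le ?E //= ?E. Qed.
Lemma leEmeet (x y : M3) : (x <= y) = (meet x y == x).
Proof.
by rewrite -[x <= y]/(le x y); case: x y => [] []; rewrite /meet /le ?E //= ?E.
Qed.

HB.instance Definition _ :=
  Order.POrder_isLattice.Build M3_display M3
    meetC joinC meetA joinA joinKI meetKU leEmeet.

Lemma le0x (x : M3) : M3_bot <= x. Proof. by []. Qed.
Lemma lex1 (x : M3) : x <= M3_top. Proof. by case: x. Qed.

HB.instance Definition _ := Order.hasBottom.Build M3_display M3 le0x.
HB.instance Definition _ := Order.hasTop.Build M3_display M3 lex1.

End M3Theory.
HB.export M3Theory.

(* Main.v *)
Require Import Defs.
From mathcomp Require Import all_boot all_order.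
From mathcomp Require Import boolp classical_sets cardinality.

Import Order.TTheory.
Local Open Scope classical_set_scope.
Local Open Scope order_scope.

(** A bi-ideal of M3 x L is determined by its fibres over the three atoms, and
    these fibres form a balanced triple of ideals of L.  The bi-ideal generated
    by (a, x), (b, y), (c, z) has as its fibres the ideals generated by the
    increasing sequences p_n, q_n, r_n evaluated at (x, y, z): passing from n to
    n + 1 is exactly one round of forced consequences, because an element below
    two of the fibres lies over the top of M3, hence below the third one
    ([gen_leP]).  The compact bi-ideals are precisely the bi-ideals
    [gen x y z] ([compact_gen], [tensor_genE]).

    If the three sequences always become stationary, every [gen x y z] is
    generated by a balanced triple ([gen_stable]).  For balanced triples, whose
    polynomials do not move, inclusion of the generated bi-ideals is the
    componentwise order ([gen_balanced_le]).  This gives the isomorphism with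
    M3[L], and meets are computed componentwise.  Joins exist in any case.

    Conversely, suppose that the tensor product is a lattice, and form the meet
    of [gen x y z] with [gen w 0 0], where w bounds all the p_n.  Its fibre over
    a contains all the p_n and its fibres over b and c are trivial; being
    compact, it is [gen u 0 0] for some u, where u is below some p_n.  So p
    stops at n ([lattice_pol_p_bounded]).  The sequences q and r are p after a
    permutation of the variables, so they stop too. *)

(** * Directed families and compact elements *)

Section Directed.
Context {d : Order.disp_t} {P : porderType d}.
Implicit Types F G : set P.

Lemma directed_finite_ub {F} :
    F !=set0 ->
    (forall x y, F x -> F y -> exists2 z, F z & x <= z /\ y <= z) ->
  forall {G}, finite_set G -> (G `<=` F)%classic -> exists2 z, F z & ubound G z.
Proof.
move=> [f0 Ff0] dirF G /finite_seqP[s ->].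
elim: s => [|x s IHs] sF; first by exists f0.
have [|z Fz sz] := IHs; first by move=> y ys; apply: sF; rewrite /= inE ys orbT.
have [|t Ft [xt zt]] := dirF x z _ Fz; first by apply: sF; rewrite /= inE eqxx.
exists t => // y; rewrite /= inE => /orP[/eqP-> //|ys].
exact: le_trans (sz y ys) zt.
Qed.

(** Compactness yields a finite part of F; directedness merges it into a single
    member of F. *)
Lemma compact_directed {F} {x s : P} :
    compact_element x -> supremums F s -> x <= s -> F !=set0 ->
    (forall x y, F x -> F y -> exists2 z, F z & x <= z /\ y <= z) ->
  exists2 z, F z & x <= z.
Proof.
move=> cx sF xs F0 dirF; have [G [finG GF [t [_ tG] xt]]] := cx F s sF xs.
have [z Fz Gz] := directed_finite_ub F0 dirF finG GF.
by exists z => //; apply: le_trans xt (tG z Gz).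
Qed.

End Directed.

(** * The polynomials p, q, r *)

Definition pol_stationary {d} (L : latticeType d) : Prop :=
  forall x y z : L, exists2 n, (0 < n)%N &
    triple_pol n x y z = triple_pol n.+1 x y z.

Section Polynomials.
Context {d : Order.disp_t} {L : latticeType d}.
Implicit Types (x y z : L) (n m : nat).

Lemma pol_p_homo {x y z n m} : (n <= m)%N -> pol_p n x y z <= pol_p m x y z.
Proof.
move/subnK <-; elim: (m - n)%N => [|k IHk] //.
by rewrite addSn; apply: le_trans IHk _; rewrite /= leUl.
Qed.

Lemma pol_q_homo {x y z n m} : (n <= m)%N -> pol_q n x y z <= pol_q m x y z.
Proof.
move/subnK <-; elim: (m - n)%N => [|k IHk] //.
by rewrite addSn; apply: le_trans IHk _; rewrite /= leUl.
Qed.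

Lemma pol_r_homo {x y z n m} : (n <= m)%N -> pol_r n x y z <= pol_r m x y z.
Proof.
move/subnK <-; elim: (m - n)%N => [|k IHk] //.
by rewrite addSn; apply: le_trans IHk _; rewrite /= leUl.
Qed.

(** Permuting the variables permutes p, q and r, so statements about p for all
    triples carry over to q and r. *)
Lemma pol_swap12 n x y z :
  [/\ pol_p n y x z = pol_q n x y z, pol_q n y x z = pol_p n x y z
    & pol_r n y x z = pol_r n x y z].
Proof.
elim: n => [|n [hp hq hr]] //=; rewrite hp hq hr.
by split=> //; congr (_ `|` _); apply: meetC.
Qed.

Lemma pol_swap13 n x y z :
  [/\ pol_p n z y x = pol_r n x y z, pol_q n z y x = pol_q n x y z
    & pol_r n z y x = pol_p n x y z].
Proof.
elim: n => [|n [hp hq hr]] //=; rewrite hp hq hr.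
by split=> //; congr (_ `|` _); apply: meetC.
Qed.

Lemma balancedP x y z :
  reflect [/\ y `&` z <= x, x `&` z <= y & x `&` y <= z] (balanced (x, y, z)).
Proof.
apply: (iffP andP) => [[/eqP xyz /eqP yxz]|[yzx xzy xyz]].
- by rewrite -yxz leIl yxz leIl xyz leIr.
have E u v w : u `&` v <= w -> u `&` w <= v -> u `&` v = u `&` w :> L.
  by move=> h1 h2; apply: le_anti; rewrite !lexI !leIl h1 h2.
split; apply/eqP; first exact: E.
by rewrite -[LHS]meetC -[RHS]meetC; apply: E => //; rewrite meetC.
Qed.

Lemma pol_balanced n x y z : balanced (x, y, z) ->
  [/\ pol_p n x y z = x, pol_q n x y z = y & pol_r n x y z = z].
Proof.
move=> /balancedP[hx hy hz].
by elim: n => [|n [hp hq hr]] //=; rewrite hp hq hr !join_l.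
Qed.

(** A stationary step says that p absorbs the meet of q and r, and likewise for
    q and r, which is the form of balancedness in [balancedP]. *)
Lemma stable_balanced n x y z :
  triple_pol n x y z = triple_pol n.+1 x y z -> balanced (triple_pol n x y z).
Proof.
by move=> [hp hq hr]; apply/balancedP; split;
  [rewrite hp|rewrite hq|rewrite hr]; rewrite leUr.
Qed.

Lemma triple_pol_stable n x y z :
  (forall m, [/\ pol_p m x y z <= pol_p n x y z, pol_q m x y z <= pol_q n x y z
               & pol_r m x y z <= pol_r n x y z]) ->
  triple_pol n x y z = triple_pol n.+1 x y z.
Proof.
move=> /(_ n.+1)[hp hq hr]; congr (_, _, _); apply: le_anti;
  by rewrite ?hp ?hq ?hr ?pol_p_homo ?pol_q_homo ?pol_r_homo.
Qed.

Lemma n_modular_stable n x y z :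
  n_modular L n -> triple_pol n x y z = triple_pol n.+1 x y z.
Proof.
move=> modL; congr (_, _, _); first exact: modL.
- have [<- _ _] := pol_swap12 n x y z.
  by have [<- _ _] := pol_swap12 n.+1 x y z.
- have [<- _ _] := pol_swap13 n x y z.
  by have [<- _ _] := pol_swap13 n.+1 x y z.
Qed.

Lemma balanced_meet x y z x' y' z' :
  balanced (x, y, z) -> balanced (x', y', z') ->
  balanced (x `&` x', y `&` y', z `&` z').
Proof.
move=> /andP[/eqP h1 /eqP h2] /andP[/eqP h1' /eqP h2'].
rewrite /balanced (meetACA x) (meetACA x _ z) (meetACA y).
by rewrite h1 h2 h1' h2' !eqxx.
Qed.

End Polynomials.

(** * Bi-ideals *)

Section BiIdeals.
Context {d1 d2 : Order.disp_t}.
Context {A : bJoinSemilatticeType d1} {B : bJoinSemilatticeType d2}.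
Implicit Types (I J : bi_ideals A B) (F G : set (bi_ideals A B)).

Lemma biidealP I : bi_ideal I. Proof. exact/asboolP/bisetP. Qed.

Lemma bi_ideals_leP {I J} : reflect (forall p, biset I p -> biset J p) (I <= J).
Proof. exact: (iffP (@subsetPset _ I J)). Qed.

Lemma bi_ideal_mem_bot I (b : B) : biset I (\bot, b).
Proof. by apply: (bi_ideal_nabla (biidealP I)); right. Qed.

Lemma bi_ideal_mem_0 I (a : A) : biset I (a, \bot).
Proof. by apply: (bi_ideal_nabla (biidealP I)); left. Qed.

Lemma bi_ideal_bigcap F :
  bi_ideal [set p | forall I, F I -> biset I p]%classic.
Proof.
split=> [a a' b b' aa bb ab I FI|[a b] ab I FI|a0 a1 b h0 h1 I FI
        |a b0 b1 h0 h1 I FI] /=.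
- exact: bi_ideal_hereditary (biidealP I) _ _ _ _ aa bb (ab I FI).
- exact: bi_ideal_nabla (biidealP I) _ ab.
- exact: bi_ideal_joinl (biidealP I) _ _ _ (h0 I FI) (h1 I FI).
- exact: bi_ideal_joinr (biidealP I) _ _ _ (h0 I FI) (h1 I FI).
Qed.

Definition bi_bigcap F : bi_ideals A B :=
  BiIdeals (introT (asboolP _) (bi_ideal_bigcap F)).

Lemma bi_bigcap_ubound F : supremums F (bi_bigcap (ubound F)).
Proof.
split=> [I FI|J FJ]; apply/bi_ideals_leP => p; last exact.
by move=> Ip J /(_ I FI)/bi_ideals_leP; apply.
Qed.

(** The pairs that are forced into every upper bound of some finite part of F.
    Unlike the union of F this set is closed under joins, since the union of two
    finite parts is finite; it is the join of F, presented so that membership is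
    witnessed by a finite part. *)
Lemma bi_ideal_finite_span F :
  bi_ideal [set p | exists G, [/\ finite_set G, G `<=` F &
    forall J, ubound G J -> biset J p]]%classic.
Proof.
have UU G0 G1 J : ubound (G0 `|` G1)%classic J -> ubound G0 J /\ ubound G1 J.
  by move=> GJ; split=> I GI; apply: GJ; [left|right].
split=> [a a' b b' aa bb [G [fG GF Gab]]|[a b] ab
        |a0 a1 b [G0 [fG0 GF0 h0]] [G1 [fG1 GF1 h1]]
        |a b0 b1 [G0 [fG0 GF0 h0]] [G1 [fG1 GF1 h1]]] /=.
- exists G; split=> // J GJ.
  exact: bi_ideal_hereditary (biidealP J) _ _ _ _ aa bb (Gab J GJ).
- exists set0; split=> [|//|J _]; first exact: finite_set0.
  exact: bi_ideal_nabla (biidealP J) _ ab.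
- exists (G0 `|` G1)%classic; split=> [||J /UU[J0 J1]].
  + by rewrite finite_setU.
  + by rewrite subUset.
  + exact: bi_ideal_joinl (biidealP J) _ _ _ (h0 J J0) (h1 J J1).
- exists (G0 `|` G1)%classic; split=> [||J /UU[J0 J1]].
  + by rewrite finite_setU.
  + by rewrite subUset.
  + exact: bi_ideal_joinr (biidealP J) _ _ _ (h0 J J0) (h1 J J1).
Qed.

Lemma mem_supremum_finite {F} {s : bi_ideals A B} {p : A * B} :
    supremums F s -> biset s p ->
  exists G, [/\ finite_set G, (G `<=` F)%classic &
    forall J, ubound G J -> biset J p].
Proof.
move=> [_ Fs]; pose U := BiIdeals (introT (asboolP _) (bi_ideal_finite_span F)).
have /bi_ideals_leP sU : s <= U; last exact: sU.
apply: Fs => I FI; apply/bi_ideals_leP => q Iq.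
exists [set I]%classic; split=> [|J ->//|J IJ]; first exact: finite_set1.
by move/bi_ideals_leP: (IJ I erefl); apply.
Qed.

Definition tensor_compact (t : tensor A B) :
  compact_element (tensor_val t) := elimT (asboolP _) (tensorP t).

End BiIdeals.

(** * The order of M3 *)

Lemma M3_leE (m m' : M3) : (m <= m') =
  match m, m' with
  | M3_bot, _ | _, M3_top | M3_a, M3_a | M3_b, M3_b | M3_c, M3_c => true
  | _, _ => false
  end.
Proof.
rewrite -[LHS]/(M3Theory.le m m').
by case: m m' => [] []; rewrite /M3Theory.le ?M3Theory.eqE.
Qed.

Lemma M3_joinE (m m' : M3) : m `|` m' =
  match m, m' with
  | M3_bot, _ | M3_a, M3_a | M3_b, M3_b | M3_c, M3_c => m'
  | _, M3_bot => m
  | _, _ => M3_top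
  end.
Proof.
rewrite -[LHS]/(M3Theory.join m m') /M3Theory.join.
by case: m m' => [] []; rewrite /M3Theory.le ?M3Theory.eqE.
Qed.

(** * The bi-ideals generated by triples *)

Section Generated.
Context {d : Order.disp_t} {L : bLatticeType d}.
Implicit Types (x y z t u v w : L) (m : M3) (n : nat).
Implicit Types (I J : bi_ideals M3 L) (S T : tensor M3 L).

(** The fibre over the top is the set of common lower bounds of all three
    coordinates, so that the formula is symmetric even for triples that are not
    balanced. *)
Definition fibre_below m t x y z : bool :=
  match m with
  | M3_bot => true
  | M3_a => t <= x
  | M3_b => t <= y
  | M3_c => t <= z
  | M3_top => [&& t <= x, t <= y & t <= z]
  end.

Lemma fibre_below_pol_homo {n n' m t x y z} : (n <= n')%N ->
  fibre_below m t (pol_p n x y z) (pol_q n x y z) (pol_r n x y z) ->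
  fibre_below m t (pol_p n' x y z) (pol_q n' x y z) (pol_r n' x y z).
Proof.
move=> nn'.
have hp t' : t' <= pol_p n x y z -> t' <= pol_p n' x y z.
  by move=> h; apply: le_trans h (pol_p_homo nn').
have hq t' : t' <= pol_q n x y z -> t' <= pol_q n' x y z.
  by move=> h; apply: le_trans h (pol_q_homo nn').
have hr t' : t' <= pol_r n x y z -> t' <= pol_r n' x y z.
  by move=> h; apply: le_trans h (pol_r_homo nn').
case: m => //=; [exact: hp|exact: hq|exact: hr|].
by move=> /and3P[/hp-> /hq-> /hr->].
Qed.

Definition gen_set x y z : set (M3 * L) :=
  [set p | exists n, fibre_below p.1 p.2
     (pol_p n x y z) (pol_q n x y z) (pol_r n x y z)]%classic.

Lemma fibre_below_hereditary m m' t t' x y z :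
  m <= m' -> t <= t' -> fibre_below m' t' x y z -> fibre_below m t x y z.
Proof.
move=> mm' tt'; have E (u : L) : t' <= u -> t <= u := le_trans tt'.
rewrite M3_leE in mm'; case: m m' mm' => [] [] //= _; try exact: E.
all: by move=> /and3P[/E h1 /E h2 /E h3]; rewrite ?h1 ?h2 ?h3.
Qed.

Lemma fibre_below_joinr m t0 t1 x y z :
  fibre_below m t0 x y z -> fibre_below m t1 x y z ->
  fibre_below m (t0 `|` t1) x y z.
Proof.
case: m => //=; rewrite !leUx; try by move=> -> ->.
by move=> /and3P[-> -> ->] /and3P[-> -> ->].
Qed.

(** Two different atoms join to the top: an element below two coordinates at
    step n gets below the third one at step n + 1. *)
Lemma fibre_below_joinl n m0 m1 t x y z :
  fibre_below m0 t (pol_p n x y z) (pol_q n x y z) (pol_r n x y z) ->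
  fibre_below m1 t (pol_p n x y z) (pol_q n x y z) (pol_r n x y z) ->
  fibre_below (m0 `|` m1) t
    (pol_p n.+1 x y z) (pol_q n.+1 x y z) (pol_r n.+1 x y z).
Proof.
have up u v w : (t <= w) || (t <= u) && (t <= v) -> t <= w `|` (u `&` v).
  by rewrite -lexI; apply: lexU2.
have := up (pol_q n x y z) (pol_r n x y z) (pol_p n x y z).
have := up (pol_p n x y z) (pol_r n x y z) (pol_q n x y z).
have := up (pol_p n x y z) (pol_q n x y z) (pol_r n x y z).
rewrite M3_joinE; case: m0 m1 => [] [] /=;
  case: (t <= pol_p n x y z) (t <= pol_q n x y z) (t <= pol_r n x y z)
    => [] [] [] //= hr hq hp _ _;
  do ?[apply/and3P; split]; by [exact: hr|exact: hq|exact: hp].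
Qed.

Lemma gen_bi_ideal x y z : bi_ideal (gen_set x y z).
Proof.
split=> [m m' t t' mm' tt' [n h]|[m t] /= [->|->]|m0 m1 t [n0 h0] [n1 h1]
        |m t0 t1 [n0 h0] [n1 h1]].
- by exists n; apply: fibre_below_hereditary h.
- by exists 0%N; case: m => //=; rewrite !le0x.
- by exists 0%N.
- exists (maxn n0 n1).+1; apply: fibre_below_joinl.
  + exact: fibre_below_pol_homo (leq_maxl _ _) h0.
  + exact: fibre_below_pol_homo (leq_maxr _ _) h1.
- exists (maxn n0 n1); apply: fibre_below_joinr.
  + exact: fibre_below_pol_homo (leq_maxl _ _) h0.
  + exact: fibre_below_pol_homo (leq_maxr _ _) h1.
Qed.

Definition gen_ideal x y z : bi_ideals M3 L :=
  BiIdeals (introT (asboolP _) (gen_bi_ideal x y z)).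

(** Each join with a meet in the recursion for p, q, r is forced in a bi-ideal:
    an element of the fibres over two atoms is in the fibre over their join, the
    top, hence in the fibre over the third atom. *)
Lemma gen_leP {x y z I} :
  gen_ideal x y z <= I <->
  [/\ biset I (M3_a, x), biset I (M3_b, y) & biset I (M3_c, z)].
Proof.
have her := bi_ideal_hereditary (biidealP I).
have all_fibres m0 m1 t0 t1 m : m0 `|` m1 = M3_top ->
    biset I (m0, t0) -> biset I (m1, t1) -> biset I (m, t0 `&` t1).
  move=> E I0 I1; apply: (her _ M3_top _ _ _ (lexx _)).
    by rewrite M3_leE; case: m.
  rewrite -E; apply: (bi_ideal_joinl (biidealP I)).
  - exact: her (lexx _) (leIl _ _) I0.
  - exact: her (lexx _) (leIr _ _) I1.
split=> [/bi_ideals_leP gI|[Ix Iy Iz]].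
  by split; apply: gI; exists 0%N; rewrite /= lexx.
have Ipol n : [/\ biset I (M3_a, pol_p n x y z), biset I (M3_b, pol_q n x y z)
                & biset I (M3_c, pol_r n x y z)].
  elim: n => [|n [Ip Iq Ir]] //=.
  split; apply: (bi_ideal_joinr (biidealP I)) => //.
  - by apply: all_fibres Iq Ir; rewrite M3_joinE.
  - by apply: all_fibres Ip Ir; rewrite M3_joinE.
  - by apply: all_fibres Ip Iq; rewrite M3_joinE.
apply/bi_ideals_leP => -[m t] [n /=]; have [Ip Iq Ir] := Ipol n.
case: m => /= [_|tp|tq|tr|/and3P[tp tq _]].
- exact: bi_ideal_mem_bot.
- exact: her (lexx _) tp Ip.
- exact: her (lexx _) tq Iq.
- exact: her (lexx _) tr Ir.
- apply: (her _ _ _ (pol_p n x y z `&` pol_q n x y z) (lexx _)).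
    by rewrite lexI tp tq.
  by apply: all_fibres Ip Iq; rewrite M3_joinE.
Qed.

(** Each of the three generating pairs is forced into the join of a family by
    some finite part of it; the union of the three parts forces all of them. *)
Lemma compact_gen x y z : compact_element (gen_ideal x y z).
Proof.
move=> F s sF /gen_leP[sx sy sz].
have [Gx [fx Fx hx]] := mem_supremum_finite sF sx.
have [Gy [fy Fy hy]] := mem_supremum_finite sF sy.
have [Gz [fz Fz hz]] := mem_supremum_finite sF sz.
exists (Gx `|` Gy `|` Gz)%classic; split.
- by rewrite !finite_setU.
- by rewrite !subUset.
- exists (bi_bigcap (ubound (Gx `|` Gy `|` Gz)%classic)).
    exact: bi_bigcap_ubound.
  apply/gen_leP; split=> J GJ.
  + by apply: hx => I GI; apply: GJ; left; left.
  + by apply: hy => I GI; apply: GJ; left; right.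
  + by apply: hz => I GI; apply: GJ; right.
Qed.

Definition gen x y z : tensor M3 L :=
  Tensor (introT (asboolP _) (compact_gen x y z)).

Lemma tensor_gen_leP {x y z T} :
  gen x y z <= T <->
  [/\ biset T (M3_a, x), biset T (M3_b, y) & biset T (M3_c, z)].
Proof. exact: (@gen_leP x y z (tensor_val T)). Qed.

Lemma gen_homo x y z x' y' z' :
  x <= x' -> y <= y' -> z <= z' -> gen x y z <= gen x' y' z'.
Proof.
move=> xx' yy' zz'.
by apply/tensor_gen_leP; split; exists 0%N.
Qed.

(** Any bi-ideal is the directed union of the bi-ideals [gen_ideal x y z] that
    it contains, so a compact one is one of them. *)
Lemma tensor_genE T : exists x y z, T = gen x y z.
Proof.
pose F := [set I | exists x y z, I = gen_ideal x y z /\ I <= T]%classic.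
have supT : supremums F (tensor_val T).
  split=> [I [x [y [z [_]]]] //|J FJ].
  have her := bi_ideal_hereditary (biidealP (tensor_val T)).
  apply/bi_ideals_leP => -[m t] Tmt.
  (* the atoms at most m generate the pair (m, t): m is the join of these *)
  pose c a := if a <= m then t else \bot.
  have Tc a : biset T (a, c a).
    rewrite /c; case: ifP => [am|_]; first exact: her am _ Tmt.
    exact: bi_ideal_mem_0.
  have Fc : F (gen_ideal (c M3_a) (c M3_b) (c M3_c)).
    by exists (c M3_a), (c M3_b), (c M3_c); split=> //; apply/gen_leP.
  move: (FJ _ Fc) => /gen_leP; rewrite /c !M3_leE.
  case: (m) => /= -[Ja Jb Jc] //; first exact: bi_ideal_mem_bot.
  have -> : M3_top = M3_a `|` M3_b by rewrite M3_joinE.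
  exact: (bi_ideal_joinl (biidealP J)).
have [||I [x [y [z [-> gT]]]] Tg] :=
  compact_directed (tensor_compact T) supT (lexx _).
- exists (gen_ideal \bot \bot \bot), \bot, \bot, \bot; split=> //.
  by apply/gen_leP; split; apply: bi_ideal_mem_0.
- move=> I J [x [y [z [-> /gen_leP[Tx Ty Tz]]]]].
  move=> [x' [y' [z' [-> /gen_leP[Tx' Ty' Tz']]]]].
  exists (gen_ideal (x `|` x') (y `|` y') (z `|` z')).
    exists (x `|` x'), (y `|` y'), (z `|` z'); split=> //.
    by apply/gen_leP; split; apply: (bi_ideal_joinr (biidealP (tensor_val T))).
  split; [apply: (gen_homo x y z)|apply: (gen_homo x' y' z')];
    by rewrite ?leUl ?leUr.
- by exists x, y, z; apply: le_anti; apply/andP.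
Qed.

(** A balanced triple is fixed by the polynomials, so the fibres of the bi-ideal
    it generates are the principal ideals of its coordinates. *)
Lemma gen_balanced_le {u v w x y z} : balanced (x, y, z) ->
  (gen u v w <= gen x y z) = [&& u <= x, v <= y & w <= z].
Proof.
move=> bal; apply/idP/and3P => [/tensor_gen_leP|[ux vy wz]];
  last exact: gen_homo.
move=> [[i hi] [j hj] [k hk]]; move: hi hj hk => /=.
have [-> _ _] := pol_balanced i _ _ _ bal.
have [_ -> _] := pol_balanced j _ _ _ bal.
by have [_ _ ->] := pol_balanced k _ _ _ bal.
Qed.

(** Running the recursion for some steps only adds consequences of the
    generators. *)
Lemma gen_stable n x y z : gen x y z =
  gen (pol_p n x y z) (pol_q n x y z) (pol_r n x y z).
Proof.
apply: le_anti; apply/andP; split.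
- apply: gen_homo; [exact: (pol_p_homo (leq0n n))|..].
  + exact: (pol_q_homo (leq0n n)).
  + exact: (pol_r_homo (leq0n n)).
- by apply/tensor_gen_leP; split; exists n => /=.
Qed.

End Generated.

(** * The tensor product as a lattice *)

Section TensorLattice.
Context {d : Order.disp_t} {L : bLatticeType d}.
Implicit Types (x y z u v w : L) (m n : nat) (S T : tensor M3 L).

(** The meet of [gen x y z] with [gen top 0 0] cuts out the fibre over the atom
    a alone.  As an element of the tensor product this meet has a generating
    triple, whose first coordinate is the largest element of the fibre. *)
Lemma lattice_pol_p_bounded x y z : is_lattice (tensor M3 L) ->
  exists n, forall m, pol_p m x y z <= pol_p n x y z.
Proof.
move=> latT; pose top := x `|` y `|` z.
have polB m :
    [/\ pol_p m x y z <= top, pol_q m x y z <= top & pol_r m x y z <= top].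
  elim: m => [|m [hp hq hr]] /=.
    by rewrite /top -joinA leUl joinCA leUl joinA leUr.
  by rewrite !leUx hp hq hr !leIx2 ?hp ?hq.
have bal t : balanced (t, \bot : L, \bot : L) by rewrite /balanced !meetx0 eqxx.
have [_ [K [Klb Kglb]]] := latT (gen x y z) (gen top \bot \bot).
have Kxyz : K <= gen x y z by apply: Klb; left.
have Ktop : K <= gen top \bot \bot by apply: Klb; right.
have [u [v [w EK]]] := tensor_genE K; move: Kxyz Ktop Kglb; rewrite EK.
move=> /tensor_gen_leP[[n /= un] _ _]; rewrite gen_balanced_le //.
rewrite !lex0 => /and3P[_ /eqP-> /eqP->] Kglb.
exists n => m; apply: le_trans un.
have : gen (pol_p m x y z) \bot \bot <= gen u \bot \bot.
  apply: Kglb => _ [->|->].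
  - apply/tensor_gen_leP; split; [by exists m => /=|exact: bi_ideal_mem_0..].
  - by rewrite gen_balanced_le // !lexx !andbT; have [] := polB m.
by rewrite gen_balanced_le // => /and3P[].
Qed.

Lemma lattice_pol_stationary : is_lattice (tensor M3 L) -> pol_stationary L.
Proof.
move=> latT x y z.
have [i hi] := lattice_pol_p_bounded x y z latT.
have [j hj] := lattice_pol_p_bounded y x z latT.
have [k hk] := lattice_pol_p_bounded z y x latT.
pose n := (maxn i (maxn j k)).+1.
have [leqi leqj leqk] : [/\ (i <= n)%N, (j <= n)%N & (k <= n)%N].
  by rewrite /n; split; apply: leqW; rewrite !leq_max leqnn ?orbT.
exists n => //; apply: triple_pol_stable => m; split.
- exact: le_trans (hi m) (pol_p_homo leqi).
- have [<- _ _] := pol_swap12 m x y z; have [<- _ _] := pol_swap12 n x y z.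
  exact: le_trans (hj m) (pol_p_homo leqj).
- have [<- _ _] := pol_swap13 m x y z; have [<- _ _] := pol_swap13 n x y z.
  exact: le_trans (hk m) (pol_p_homo leqk).
Qed.

Lemma tensor_balanced_genE T : pol_stationary L ->
  exists x y z, balanced (x, y, z) /\ T = gen x y z.
Proof.
move=> stat; have [x [y [z ->]]] := tensor_genE T.
have [n _ st] := stat x y z.
exists (pol_p n x y z), (pol_q n x y z), (pol_r n x y z).
by split; [exact: stable_balanced st|exact: gen_stable].
Qed.

(** Joins come from joining the generators.  For meets, balanced generators
    reduce inclusion to comparing coordinates. *)
Lemma stationary_is_lattice : pol_stationary L -> is_lattice (tensor M3 L).
Proof.
move=> stat S T.
have [x [y [z [bal ->]]]] := tensor_balanced_genE S stat.
have [x' [y' [z' [bal' ->]]]] := tensor_balanced_genE T stat.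
split.
- exists (gen (x `|` x') (y `|` y') (z `|` z')); split.
  + by move=> _ [->|->]; apply: gen_homo; rewrite ?leUl ?leUr.
  + move=> U US.
    have /tensor_gen_leP[Ux Uy Uz] : gen x y z <= U by apply: US; left.
    have /tensor_gen_leP[Ux' Uy' Uz'] : gen x' y' z' <= U by apply: US; right.
    apply/tensor_gen_leP.
    by split; apply: (bi_ideal_joinr (biidealP (tensor_val U))).
- exists (gen (x `&` x') (y `&` y') (z `&` z')); split.
  + by move=> _ [->|->]; apply: gen_homo; rewrite ?leIl ?leIr.
  + move=> U; have [u [v [w ->]]] := tensor_genE U => US.
    have : gen u v w <= gen x y z by apply: US; left.
    have : gen u v w <= gen x' y' z' by apply: US; right.
    rewrite !gen_balanced_le ?balanced_meet // !lexI.
    by move=> /and3P[-> -> ->] /and3P[-> -> ->].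
Qed.

Definition gen_triple (t : balanced_triples L) : tensor M3 L :=
  gen (btriple t).1.1 (btriple t).1.2 (btriple t).2.

Lemma gen_triple_mono : {mono gen_triple : s t / s <= t}.
Proof.
move=> [[[u v] w] bs] [[[x y] z] bt]; rewrite /gen_triple gen_balanced_le //=.
by rewrite andbA.
Qed.

Lemma stationary_poset_iso :
  pol_stationary L -> poset_iso (tensor M3 L) (balanced_triples L).
Proof.
move=> stat.
have surj T : exists t, gen_triple t = T.
  have [x [y [z [bal ->]]]] := tensor_balanced_genE T stat.
  by exists (BalancedTriple bal).
pose f T := sval (cid (surj T)).
have fK : cancel f gen_triple by move=> T; apply: svalP (cid (surj T)).
have gK : cancel gen_triple f.
  by apply: inj_can_sym fK _; apply: inc_inj gen_triple_mono.
by exists f => [|S T]; [exists gen_triple|rewrite -gen_triple_mono !fK].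
Qed.

End TensorLattice.

Theorem corollary6p3 (d : Order.disp_t) (L : bLatticeType d) :
  [/\ is_lattice (tensor M3 L) <->
        (forall x y z : L, exists2 n : nat, (0 < n)%N &
           triple_pol n x y z = triple_pol n.+1 x y z),
      is_lattice (tensor M3 L) ->
        poset_iso (tensor M3 L) (balanced_triples L) &
      forall n : nat, (0 < n)%N -> n_modular L n ->
        is_lattice (tensor M3 L) /\
        poset_iso (tensor M3 L) (balanced_triples L)].
Proof.
split=> [|latT|n n_gt0 modL].
- by split; [exact: lattice_pol_stationary|exact: stationary_is_lattice].
- exact/stationary_poset_iso/lattice_pol_stationary.
- have stat : pol_stationary L.
    by move=> x y z; exists n => //; apply: n_modular_stable.
  by split; [exact: stationary_is_lattice|exact: stationary_poset_iso].
Qed.
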